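(* Let $R$ be a ring and let $M$ be a left $R$-module with a $u$-basis (i.e. every nonzero submodule of $M$ contains a uniform submodule). If $\omega(M)\leq\omega^c(M)$, then $\omega^c(M)=\chi^c(M)$.
   Context: Rings are associative with unity and modules are unitary left modules. A nontrivial submodule of $M$ is a submodule different from $0$ and $M$. The intersection graph $G(M)$ is the simple graph whose vertices are the nontrivial submodules of $M$, two distinct vertices being adjacent iff their intersection is nonzero. The complement graph $G^c(M)$ has the same vertices, two distinct vertices being adjacent iff their intersection is zero. $\omega(M)$ and $\omega^c(M)$ are the clique numbers of $G(M)$ and $G^c(M)$, where the clique number is the supremum of the cardinalities of cliques (sets of pairwise adjacent vertices). $\chi^c(M)$ is the chromatic number of $G^c(M)$: the least cardinality of a set of colors admitting a coloring of the vertices in which adjacent vertices get different colors. All these are cardinal numbers. A nonzero module is uniform if any two of its nonzero submodules have nonzero intersection. A $u$-basis of $M$ is a set of uniform submodules whose sum is direct and essential in $M$ (i.e. the sum meets every nonzero submodule of $M$ nontrivially); it is known that $M$ has a $u$-basis iff every nonzero submodule of $M$ contains a uniform submodule. *)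

(* Defs.v *)
From mathcomp Require Import all_boot all_order all_algebra.
From mathcomp Require Import all_classical.

Set Implicit Arguments.
Unset Strict Implicit.
Unset Printing Implicit Defensive.

Import GRing.Theory.
Local Open Scope classical_set_scope.
Local Open Scope card_scope.
Local Open Scope ring_scope.

(* A cardinal number is represented by a set having that cardinality; cardinals
   are compared with [#<=] and [#=]. *)

Definition least_card (Q : forall U : Type, set U -> Prop)
    (T : Type) (K : set T) : Prop :=
  Q T K /\ forall (U : Type) (K' : set U), Q U K' -> K #<= K'.

(* Cardinals are well-ordered. By Zorn, take a maximal set S of choice functions
   on P that pairwise differ at every A in P: some evaluation S -> A is onto. *)
Lemma card_le_wf (T : Type) (P : set (set T)) (A0 : set T) :
  P A0 -> exists2 A, P A & forall B, P B -> A #<= B.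
Proof.
move=> PA0.
have [P0|P0] := pselect (P set0).
  by exists set0 => // B _; exact: card_ge0.
have Pn A : P A -> exists x, A x.
  move=> PA; apply: contrapT => nA; apply: P0; rewrite (_ : set0 = A) //.
  by apply/seteqP; split=> x // Ax; apply: nA; exists x.
have [t0 _] := Pn _ PA0.
pose good (S : set (set T -> T)) :=
  (forall f, S f -> forall A, P A -> A (f A)) /\
  (forall f g A, S f -> S g -> P A -> f A = g A -> f = g).
have [|S [[S1 S2] Smax]] := @Zorn_bigcup (set T -> T) good.
  move=> F Fgood Ftot; split=> [f [X FX Xf] A PA|f g A [X FX Xf] [Y FY Yg] PA].
    by have [X1 _] := Fgood _ FX; exact: X1 Xf A PA.
  have [XY|YX] := Ftot _ _ FX FY.
    by apply: (Fgood _ FY).2 => //; exact: XY.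
  by apply: (Fgood _ FX).2 => //; exact: YX.
have inj A : P A -> [set f A | f in S] #= S.
  move=> PA; apply: inj_card_eq => f g /set_mem Sf /set_mem Sg; exact: S2.
have [[A [PA SA]]|nonto] :=
    pselect (exists A, P A /\ A `<=` [set f A | f in S]).
  exists A => // B PB; apply: (card_le_trans (subset_card_le SA)).
  rewrite (card_le_eql (inj _ PA)) -(card_le_eql (inj _ PB)).
  by apply: subset_card_le => _ [f Sf <-]; exact: S1 Sf B PB.
have new A : exists x, P A -> A x /\ ~ [set f A | f in S] x.
  have [PA|nPA] := pselect (P A); last by exists t0.
  apply: contrapT => nx; apply: nonto; exists A; split=> // x Ax.
  by apply: contrapT => nSx; apply: nx; exists x.
have [h hP] := choice new.
exfalso; apply: (Smax (S `|` [set h])).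
  split; first by move=> f; left.
  move=> /(_ h) /(_ (or_intror erefl)) Sh.
  by have [_] := hP _ PA0; apply; exists h.
split=> [f [Sf|->] A PA|f g A]; [exact: S1 Sf A PA|exact: (hP _ PA).1|].
move=> [Sf|->] [Sg|->] PA // fg; first exact: S2 fg.
  by have [_ []] := hP _ PA; exists f.
by have [_ []] := hP _ PA; exists g.
Qed.

Lemma card_le_total (T U : Type) (A : set T) (B : set U) : A #<= B \/ B #<= A.
Proof.
pose A' := @inl T U @` A; pose B' := @inr T U @` B.
have AA' : A' #= A by apply: inj_card_eq => x y _ _ [].
have BB' : B' #= B by apply: inj_card_eq => x y _ _ [].
have [C [->|->] Cmin] := @card_le_wf _ [set A'; B'] A' (or_introl erefl).
  left; rewrite -(card_le_eql AA') -(card_le_eqr BB').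
  by apply: Cmin; right.
right; rewrite -(card_le_eql BB') -(card_le_eqr AA').
by apply: Cmin; left.
Qed.

Lemma ex_least_card (Q : forall U : Type, set U -> Prop) (T : Type) (K : set T) :
  (forall (U V : Type) (A : set U) (B : set V), A #<= B -> Q U A -> Q V B) ->
  Q T K -> exists K0 : set T, least_card Q K0.
Proof.
move=> Qup QK; have [K0 QK0 K0min] := @card_le_wf T (Q T) K QK.
exists K0; split=> // U K' QK'.
have [//|/card_subP[C CK' CK0]] := card_le_total K0 K'.
rewrite -(card_le_eqr CK'); apply: K0min; apply: Qup QK'.
by move: CK'; rewrite card_eq_le => /andP[].
Qed.

Record simple_graph (T : Type) := SimpleGraph {
  vertex : set T;
  adj : T -> T -> Prop;
  adj_sym : forall x y, adj x y -> adj y x;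
  adj_irr : forall x, ~ adj x x
}.

Section Graph.
Variables (T : Type) (G : simple_graph T).

Definition clique (C : set T) : Prop :=
  C `<=` vertex G /\ forall x y, C x -> C y -> x <> y -> adj G x y.

Definition clique_bound (U : Type) (K : set U) : Prop :=
  forall C, clique C -> C #<= K.

(* Vertices and colors range over the subtypes given by the sets [vertex G]
   and [K]. *)
Definition colorable (U : Type) (K : set U) : Prop :=
  exists c : vertex G -> K,
    forall x y : vertex G, adj G (val x) (val y) -> c x <> c y.

Lemma ex_clique_number : exists K : set T, least_card clique_bound K.
Proof.
apply: (ex_least_card (K := vertex G)) => [U V A B AB QA C /QA CA|C [CV _]].
  exact: card_le_trans AB.
exact: subset_card_le.
Qed.

Lemma ex_chromatic_number : exists K : set T, least_card colorable K.
Proof.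
apply: (ex_least_card (K := vertex G)) => [U V A B /card_leP[f] [c cP]|].
  exists (f \o c) => x y /cP cxy /= /(inj (f := f)) fxy.
  by apply: cxy; apply: fxy; exact/mem_set.
by exists id => x y xy exy; move: xy; rewrite exy; exact: adj_irr.
Qed.

(* The supremum of the cardinalities of the cliques, i.e. their least cardinal
   upper bound. *)
Definition clique_number : set T := sval (cid ex_clique_number).

Definition chromatic_number : set T := sval (cid ex_chromatic_number).

Lemma clique_numberP : least_card clique_bound clique_number.
Proof. exact: svalP (cid ex_clique_number). Qed.

Lemma chromatic_numberP : least_card colorable chromatic_number.
Proof. exact: svalP (cid ex_chromatic_number). Qed.

End Graph.

Section Module.
Variables (R : pzRingType) (M : lmodType R).
Implicit Types (N L S : set M) (B : set (set M)).

Definition submodule N : Prop := GRing.submod_closed (mem N).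

Definition nonzero_submodule N : Prop := submodule N /\ N <> [set 0].

Definition nontrivial_submodule N : Prop :=
  [/\ submodule N, N <> [set 0] & N <> setT].

Definition uniform N : Prop :=
  nonzero_submodule N /\
  forall L1 L2, nonzero_submodule L1 -> nonzero_submodule L2 ->
    L1 `<=` N -> L2 `<=` N -> L1 `&` L2 <> [set 0].

(* All finite sums of elements of members of B. *)
Definition sum_submodules B : set M :=
  [set x | exists2 s : seq M,
     (forall y, y \in s -> exists2 N, B N & N y) & x = \sum_(y <- s) y].

Definition direct_sum B : Prop :=
  forall N, B N -> N `&` sum_submodules (B `\ N) = [set 0].

Definition essential S : Prop :=
  forall N, nonzero_submodule N -> S `&` N <> [set 0].

Definition u_basis B : Prop :=
  [/\ forall N, B N -> uniform N, direct_sum B & essential (sum_submodules B)].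

Lemma intersection_adj_sym N L :
  N <> L /\ N `&` L <> [set 0] -> L <> N /\ L `&` N <> [set 0].
Proof. by rewrite setIC => -[/nesym]. Qed.

Lemma intersection_adj_irr N : ~ (N <> N /\ N `&` N <> [set 0]).
Proof. by case. Qed.

Definition intersection_graph : simple_graph (set M) :=
  SimpleGraph nontrivial_submodule intersection_adj_sym intersection_adj_irr.

Lemma cointersection_adj_sym N L :
  N <> L /\ N `&` L = [set 0] -> L <> N /\ L `&` N = [set 0].
Proof. by rewrite setIC => -[/nesym]. Qed.

Lemma cointersection_adj_irr N : ~ (N <> N /\ N `&` N = [set 0]).
Proof. by case. Qed.

Definition cointersection_graph : simple_graph (set M) :=
  SimpleGraph nontrivial_submodule cointersection_adj_sym cointersection_adj_irr.

End Module.

Arguments intersection_graph {R} M.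
Arguments cointersection_graph {R} M.

(* Main.v *)
(* Meeting nontrivially is an equivalence relation on uniform submodules.  A
   system of representatives of the nontrivial ones is a clique of the
   complement graph; coloring each vertex N by the representative of some
   uniform submodule of N is a proper coloring of that graph, because uniform
   submodules of the same class that lie in N and L force N and L to meet.
   That uniform submodules exist inside N is seen by taking a nonzero element
   of N that is the shortest possible sum y + z + ... of elements of members of
   a u-basis: the cyclic module it generates is isomorphic to Ry. *)
Require Import Defs.
From mathcomp Require Import all_boot all_order all_algebra.
From mathcomp Require Import all_classical.

Set Implicit Arguments.
Unset Strict Implicit.

Local Open Scope card_scope.

(** * Cliques and proper colorings of a graph *)

Section Graph.
Local Open Scope classical_set_scope.
Context {T : Type} (G : simple_graph T).

(** A proper coloring is injective on every clique. *)
Lemma colorable_clique_bound (U : Type) (K : set U) :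
  colorable G K -> clique_bound G K.
Proof.
move=> [c cP] C [CV Cadj].
have CVm x : x \in C -> x \in vertex G by move=> /set_mem/CV/mem_set.
pose f (x : C) : K := c (SigSub (CVm (val x) (valP x))).
have finj : {in [set: C] &, injective f}.
  move=> x y _ _ fxy; apply: val_inj; apply: contrapT => xy.
  by apply: (cP _ _ _ fxy); exact: Cadj (set_valP x) (set_valP y) xy.
rewrite -(card_le_eql (card_setT C)) -(card_le_eqr (card_setT K)).
rewrite -(card_le_eql (inj_card_eq finj)).
exact: subset_card_le.
Qed.

(** [C] closes the chain: the chromatic number is at most [C], which is at most the clique number,
    which is at most the chromatic number. *)
Lemma clique_number_chromatic (C : set T) :
  clique G C -> colorable G C -> clique_number G #= chromatic_number G.
Proof.
have [ub_om om_min] := clique_numberP G.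
have [_ ch_min] := chromatic_numberP G.
move=> cliqueC colC; rewrite card_eq_le om_min; last first.
  exact: colorable_clique_bound (chromatic_numberP G).1.
exact: card_le_trans (ch_min _ _ colC) (ub_om _ cliqueC).
Qed.

End Graph.

(** * Submodules and uniform submodules *)

Section Module.
Local Open Scope classical_set_scope.
Local Open Scope ring_scope.
Import GRing.Theory.
Context {R : pzRingType} {M : lmodType R}.
Implicit Types (N L U V W : set M) (B : set (set M)) (x y z : M).

Lemma submodule_comb N (a : R) x y :
  submodule N -> N x -> N y -> N (a *: x + y).
Proof.
by case=> _ Nlin Nx Ny; apply/set_mem; apply: Nlin; apply/mem_set.
Qed.

Lemma submodule0 N : submodule N -> N 0.
Proof. by case=> /set_mem. Qed.

Lemma submoduleZ N (a : R) x : submodule N -> N x -> N (a *: x).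
Proof.
move=> sN Nx; rewrite -[a *: x]addr0.
by apply: submodule_comb => //; exact: submodule0.
Qed.

Lemma submoduleD N x y : submodule N -> N x -> N y -> N (x + y).
Proof. by move=> sN Nx Ny; rewrite -[x]scale1r; apply: submodule_comb. Qed.

Lemma submoduleI N L : submodule N -> submodule L -> submodule (N `&` L).
Proof.
move=> sN sL; split; first by apply/mem_set; split; apply: submodule0.
move=> a x y /set_mem[Nx Lx] /set_mem[Ny Ly]; apply/mem_set.
by split; apply: submodule_comb.
Qed.

Lemma submodule_neq0 N :
  submodule N -> N <> [set 0] <-> exists2 x, N x & x <> 0.
Proof.
move=> sN; split=> [N0|[x Nx x0] N0]; last by move: Nx; rewrite N0.
apply: contrapT => nx; apply: N0; apply/seteqP; split=> [x Nx|_ ->].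
  by apply: contrapT => x0; apply: nx; exists x.
exact: submodule0.
Qed.

Lemma submoduleI_neq0 N L : submodule N -> submodule L ->
  N `&` L <> [set 0] <-> exists x, [/\ N x, L x & x <> 0].
Proof.
move=> sN sL; rewrite submodule_neq0; last exact: submoduleI.
by split=> [[x [Nx Lx] x0]|[x [Nx Lx x0]]]; exists x.
Qed.

Definition cyclic_submodule x : set M := [set r *: x | r in [set: R]].

Lemma submodule_cyclic x : submodule (cyclic_submodule x).
Proof.
split; first by apply/mem_set; exists 0; rewrite ?scale0r.
move=> a _ _ /set_mem[r _ <-] /set_mem[s _ <-]; apply/mem_set.
by exists (a * r + s); rewrite // scalerDl scalerA.
Qed.

(* The hypothesis says that [r *: x |-> r *: y] is an isomorphism from Rx onto
   the nonzero submodule Ry of U. *)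
Lemma uniform_cyclic U x y : uniform U -> U y -> x <> 0 ->
  (forall r : R, r *: x = 0 <-> r *: y = 0) -> uniform (cyclic_submodule x).
Proof.
move=> [[sU _] Uunif] Uy x0 xy.
have nz (r : R) : r *: x <> 0 -> nonzero_submodule (cyclic_submodule (r *: y)).
  move=> rx0; split; first exact: submodule_cyclic.
  apply/submodule_neq0; first exact: submodule_cyclic.
  by exists (r *: y); [exists 1; rewrite ?scale1r|move=> /xy].
have subU (r : R) : cyclic_submodule (r *: y) `<=` U.
  by move=> _ [s _ <-]; apply: (submoduleZ _ sU); exact: submoduleZ.
split.
  split; first exact: submodule_cyclic.
  apply/submodule_neq0; first exact: submodule_cyclic.
  by exists x => //; exists 1; rewrite ?scale1r.
move=> L1 L2 [sL1 /(submodule_neq0 sL1)[u1 L1u1 u10]].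
move=> [sL2 /(submodule_neq0 sL2)[u2 L2u2 u20]] L1x L2x.
have [r1 _ r1x] := L1x _ L1u1; have [r2 _ r2x] := L2x _ L2u2; subst u1 u2.
(* A common nonzero element is found inside [U], in the form [a r1 y = b r2 y]; since [a r1 - b r2]
   kills [y], it kills [x] too. *)
have /submoduleI_neq0[||_ [[a _ <-] [b _ /esym aby] ay0]] :=
  Uunif _ _ (nz _ u10) (nz _ u20) (subU _) (subU _).
- exact: submodule_cyclic.
- exact: submodule_cyclic.
apply/submoduleI_neq0 => //; exists (a *: (r1 *: x)); split.
- exact: submoduleZ.
- have -> : a *: (r1 *: x) = b *: (r2 *: x); last exact: submoduleZ.
  apply/eqP; rewrite -subr_eq0 !scalerA -scalerBl; apply/eqP/xy.
  by rewrite scalerBl -!scalerA aby subrr.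
- by rewrite scalerA => /xy; rewrite -scalerA.
Qed.

Lemma u_basis_uniform_sub B N : u_basis B -> nonzero_submodule N ->
  exists2 U, uniform U & U `<=` N.
Proof.
move=> [Bunif Bdir Bess] [sN N0].
pose P n := `[< exists s : seq M, [/\ size s = n,
  forall y, y \in s -> exists2 L, B L & L y, N (\sum_(y <- s) y)
  & \sum_(y <- s) y <> 0] >].
have exP : exists n, P n.
  suff [x [[s sB xs] Nx] x0] :
      exists2 x, (sum_submodules B `&` N) x & x <> 0.
    by exists (size s); apply/asboolP; exists s; rewrite -xs.
  apply: contrapT => nx; apply: (Bess N) => //; apply/seteqP.
  split=> [x Sx|_ ->]; first by apply: contrapT => x0; apply: nx; exists x.
  by split; [exists [::]; rewrite ?big_nil|exact: submodule0].
case: (ex_minnP exP) => n /asboolP[s [sn sB Ns s0]] nmin.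
have short (t : seq M) : (size t < n)%N ->
    (forall y, y \in t -> exists2 L, B L & L y) ->
    N (\sum_(y <- t) y) -> \sum_(y <- t) y = 0.
  move=> tn tB Nt; apply: contrapT => t0; move: tn; rewrite ltnNge nmin//.
  by apply/asboolP; exists t.
case: s sn sB Ns s0 => [|y s] sn sB Ns s0; first by move: s0; rewrite big_nil.
have [U BU Uy] := sB y (mem_head _ _).
have [[sU _] _] := Bunif _ BU.
have sBs z : z \in s -> exists2 L, B L & L z.
  by move=> zs; apply: sB; rewrite inE zs orbT.
(* Otherwise [y] and [z] merge into the single term [y + z] of [U], giving a sum with one term
   fewer. *)
have sU' z : z \in s -> ~ U z.
  move=> zs Uz; apply: s0; rewrite big_cons (big_rem z zs)/= addrA.
  have := short (y + z :: rem z s); rewrite big_cons; apply.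
  - by rewrite -sn /= size_rem// prednK//; case: (s) zs.
  - move=> w; rewrite inE => /predU1P[->|/mem_rem/sBs//].
    by exists U => //; exact: submoduleD.
  - by move: Ns; rewrite big_cons (big_rem z zs)/= addrA.
(* The tail thus avoids [U] altogether, so directness can separate it from [y]. *)
have scaleB (r : R) z : z \in [seq r *: z | z <- s] ->
    exists2 L, (B `\ U) L & L z.
  move=> /mapP[w ws ->]; have [L BL Lw] := sBs _ ws.
  have [[sL _] _] := Bunif _ BL.
  exists L; last exact: submoduleZ.
  by split=> // LU; apply: (sU' _ ws); rewrite -LU.
have scale_sum (r : R) t :
    \sum_(z <- [seq r *: z | z <- t]) z = r *: \sum_(z <- t) z.
  by rewrite big_map scaler_sumr.
exists (cyclic_submodule (\sum_(z <- y :: s) z)); last first.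
  by move=> _ [r _ <-]; apply: submoduleZ.
apply: (uniform_cyclic (U := U) (y := y)) => // [|r]; first exact: Bunif.
split=> [rx|ry].
  suff : (U `&` sum_submodules (B `\ U)) (r *: y) by rewrite Bdir.
  split; first exact: submoduleZ.
  exists [seq - r *: z | z <- s]; first exact: scaleB.
  move: rx; rewrite scale_sum big_cons scalerDr => /eqP.
  by rewrite addr_eq0 scaleNr => /eqP.
(* Once [r] kills [y], only the shorter tail survives, and minimality forces its sum to vanish. *)
have rs : r *: \sum_(z <- y :: s) z = \sum_(z <- [seq r *: z | z <- s]) z.
  by rewrite scale_sum big_cons scalerDr ry add0r.
rewrite rs; apply: short.
- by rewrite -sn size_map.
- by move=> z /scaleB[L [BL _] Lz]; exists L.
- by rewrite -rs; exact: submoduleZ.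
Qed.

(** The intersections of [V] with [U] and with [W] are nonzero submodules of the uniform module [V],
    so they meet. *)
Lemma uniform_meet_trans U V W : uniform U -> uniform V -> uniform W ->
  U `&` V <> [set 0] -> V `&` W <> [set 0] -> U `&` W <> [set 0].
Proof.
move=> [[sU _] _] [[sV _] Vunif] [[sW _] _] UV VW.
have sUV := submoduleI sU sV; have sVW := submoduleI sV sW.
have /(submoduleI_neq0 sUV sVW)[x [[Ux _] [_ Wx] x0]] :=
  Vunif _ _ (conj sUV UV) (conj sVW VW) (@subIsetr _ _ _) (@subIsetl _ _ _).
by apply/submoduleI_neq0 => //; exists x.
Qed.

Lemma cointersection_clique_colorable :
  (forall N, nonzero_submodule N -> exists2 U, uniform U & U `<=` N) ->
  exists2 C, clique (cointersection_graph M) C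
           & colorable (cointersection_graph M) C.
Proof.
move=> unif_sub.
pose nunif U := uniform U /\ U <> setT.
pose cls U := [set V | nunif V /\ U `&` V <> [set 0]].
have cls_eq U V : nunif U -> nunif V -> U `&` V <> [set 0] -> cls U = cls V.
  move=> [uU _] [uV _] UV; apply/seteqP; split=> W [[uW WT] mW]; split=> //.
    by apply: (@uniform_meet_trans V U W) => //; rewrite setIC.
  exact: (@uniform_meet_trans U V W).
(* Choosing from the class itself makes equal classes share one representative; [set0] is a dummy
   value for the empty class. *)
have /choice[rep repP] (A : set (set M)) : exists V, A !=set0 -> A V.
  by have [[V AV]|nA] := pselect (A !=set0); [exists V|exists set0].
have repU U : nunif U -> cls U (rep (cls U)).
  move=> nU; apply: repP; exists U; split=> //; rewrite setIid.
  by case: nU => -[[]].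
pose C := [set rep (cls U) | U in nunif]; exists C.
  split=> [_ [U nU <-]|_ _ [U nU <-] [V nV <-] neq].
    by have [[[[]]]] := repU U nU.
  (* Representatives that meet have the same class, hence coincide. *)
  split=> //; apply: contrapT => meet; apply: neq.
  have [nrU mU] := repU U nU; have [nrV mV] := repU V nV.
  rewrite (cls_eq _ _ nU nrU mU) (cls_eq _ _ nrU nrV meet).
  by rewrite -(cls_eq _ _ nV nrV mV).
have /choice[u uP] : forall N : vertex (cointersection_graph M), exists U,
    nunif U /\ U `<=` val N.
  move=> N; have [sN N0 NT] := set_valP N.
  have [U uU UN] := unif_sub _ (conj sN N0); exists U.
  split=> //; split=> // UT.
  by apply: NT; apply/seteqP; split=> // x _; apply: UN; rewrite UT.
have uC v : rep (cls (u v)) \in C.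
  by apply/mem_set; exists (u v) => //; exact: (uP v).1.
exists (fun v => SigSub (uC v)) => v w [_ vw0] /(congr1 val)/= eqr.
have [[nv uv] [nw uw]] := (uP v, uP w).
have [nrv mv] := repU _ nv; have [nrw mw] := repU _ nw.
have [sv _ _] := set_valP v; have [sw _ _] := set_valP w.
have [[[suv _] _] _] := nv; have [[[suw _] _] _] := nw.
(* Both submodules meet their common representative, so transitivity applies. *)
have : u v `&` u w <> [set 0].
  apply: (uniform_meet_trans nv.1 nrv.1 nw.1 mv).
  by rewrite eqr setIC.
move=> /(submoduleI_neq0 suv suw)[x [/uv vx /uw wx x0]].
by move: vw0; apply/(submoduleI_neq0 sv sw); exists x.
Qed.

End Module.

Theorem theorem4p4 (R : pzRingType) (M : lmodType R) :
  (exists B : set (set M), u_basis B) ->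
  clique_number (intersection_graph M)
    #<= clique_number (cointersection_graph M) ->
  clique_number (cointersection_graph M)
    #= chromatic_number (cointersection_graph M).
Proof.
move=> [B uB] _.
have [C cliqueC colC] :=
  cointersection_clique_colorable (fun N => u_basis_uniform_sub uB (N := N)).
exact: clique_number_chromatic cliqueC colC.
Qed.
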